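(* Let $T$ be a well-pruned nonspecial $\omega_1$-tree. Then $\diamondsuit^*$ implies $\diamondsuit_T$.
   Context: A tree is a partial order $(T,<_T)$ in which the set of predecessors of each node is well-ordered; every tree is assumed to have a root, denoted $\emptyset$. For $t\in T$, $t{\downarrow}=\{s\in T\mid s<_T t\}$, $\mathrm{ht}(t)$ is the order type of $t{\downarrow}$, and $T_\alpha$ is the set of nodes of height $\alpha$. The height of $T$ is the least $\alpha$ with $T_\alpha=\emptyset$. An $\omega_1$-tree is a tree of height $\omega_1$ all of whose levels $T_\alpha$ are countable. A tree $T$ of height $\kappa$ is well-pruned if for all $\alpha<\beta<\kappa$ and $s\in T_\alpha$ there is $t\in T_\beta$ with $s<_T t$. An antichain is a set of pairwise incomparable nodes. A set $U\subseteq T$ is special if it is a union of at most countably many antichains; otherwise it is nonspecial. For $X\subseteq T$, a map $f:X\to T$ is regressive if $f(t)<_T t$ for all $t\in X\setminus\{\emptyset\}$. For $T$ of height $\omega_1$, $NS^T$ is the ideal of all $B\subseteq T$ for which there is a regressive $f:B\to T$ such that $f^{-1}(\{t\})$ is special for every $t\in T$. For a nonspecial tree $T$ of height $\omega_1$, $\diamondsuit_T$ asserts that there is a sequence $(D_t\mid t\in T)$ with $D_t\subseteq t{\downarrow}$ for all $t\in T$ such that for every $X\subseteq T$, $\{t\in T\mid X\cap t{\downarrow}=D_t\}\notin NS^T$. $\diamondsuit^*$ asserts that there is $(\mathcal D_\alpha)_{\alpha<\omega_1}$ with $\mathcal D_\alpha\subseteq\mathcal P(\alpha)$ and $|\mathcal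 D_\alpha|\le\omega$ such that for every $X\subseteq\omega_1$ the set $\{\alpha<\omega_1\mid X\cap\alpha\in\mathcal D_\alpha\}$ contains a club. *)

(* Defs.v *)
From mathcomp Require Import all_boot all_order.
From mathcomp Require Import boolp classical_sets functions cardinality wochoice.

Set Implicit Arguments.
Unset Strict Implicit.
Unset Printing Implicit Defensive.

Import Order.TTheory.
Local Open Scope order_scope.
Local Open Scope classical_set_scope.

Definition below {d} {T : porderType d} (t : T) : set T := [set s | s < t].

Definition order_isomorphic {d d'} {S : porderType d} {S' : porderType d'}
    (A : set S) (B : set S') : Prop :=
  exists f : S -> S', set_bij A B f /\ {in A &, {mono f : x y / x <= y}}.

(* An ordinal is represented by a well-ordered type [W]; the ordinals below it
   are the elements of [W], and [a : W], seen as a von Neumann ordinal, is the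
   initial segment [below a]. *)
Definition is_omega1 {d} (W : orderType d) : Prop :=
  [/\ well_order (<=%O : rel W),
      ~ countable [set: W]
    & forall a : W, countable (below a)].

Definition club {d} {W : orderType d} (C : set W) : Prop :=
  (forall a, exists2 c, C c & a < c) /\
  (* [a] is the supremum of [C `&` below a] and is not the least element *)
  (forall a, C `&` below a !=set0 ->
     (forall b, b < a -> exists2 c, C c & b < c < a) -> C a).

Definition diamond_star {d} (W : orderType d) : Prop :=
  exists D : W -> set (set W),
    [/\ forall a A, D a A -> A `<=` below a,
        forall a, countable (D a)
      & forall X : set W,
          exists2 C, club C & C `<=` [set a | D a (X `&` below a)]].

(* The root is [\bot]. *)
Definition is_tree {d} (T : bPOrderType d) : Prop :=
  forall t : T, wo_chain (<=%O : rel T) [pred s | s < t].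

Definition level {d d'} (T : bPOrderType d) {W : orderType d'} (a : W) :
    set T :=
  [set t | order_isomorphic (below t) (below a)].
Arguments level {d d'} T {W} a.

(* The height of [T] is the order type of [W]: the levels below it are
   nonempty, and the level at [W] itself is empty. *)
Definition has_height {d d'} (T : bPOrderType d) (W : orderType d') : Prop :=
  (forall a : W, level T a !=set0) /\
  (forall t : T, ~ order_isomorphic (below t) [set: W]).

Definition omega1_tree {d d'} (T : bPOrderType d) (W : orderType d') : Prop :=
  [/\ is_tree T, has_height T W & forall a : W, countable (level T a)].

Definition well_pruned {d d'} (T : bPOrderType d) (W : orderType d') : Prop :=
  forall (a b : W) (s : T), a < b -> level T a s ->
    exists2 t, level T b t & s < t.

Definition antichain {d} {T : porderType d} (A : set T) : Prop :=
  forall s t, A s -> A t -> s <> t -> s >< t.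

Definition special {d} {T : porderType d} (U : set T) : Prop :=
  exists F : set (set T),
    [/\ countable F, F `<=` antichain & U = \bigcup_(A in F) A].

Definition regressive {d} {T : bPOrderType d} (X : set T) (f : T -> T) : Prop :=
  forall t, X t -> t <> \bot -> f t < t.

Definition NS {d} (T : bPOrderType d) : set (set T) :=
  [set B | exists f : T -> T,
     regressive B f /\ forall t, special (B `&` f @^-1` [set t])].

Definition diamond_tree {d} (T : bPOrderType d) : Prop :=
  exists D : T -> set T,
    (forall t, D t `<=` below t) /\
    (forall X : set T, ~ NS [set t | X `&` below t = D t]).

(* Main.v *)
(** If [T] were in [NS T], iterating a regressive map with special fibres would
    lead from each node to the root in finitely many steps, and the words of
    colours met on the way would show [T] to be special. So [T] is not in
    [NS T], and [NS T] is a sigma-ideal that contains the set of nodes whose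
    height avoids a given club.

    Code [T * omega] injectively by [e : T -> nat -> W], and let [E a n]
    enumerate the countably many guesses of diamond-star at [a]. Kunen's trick
    then applies: the n-th candidate is [D_t = { s < t | e s n \in E (h t) n }],
    where [h] is the height. If each candidate failed at some [X n], guessing
    the code of the disjoint union of the [X n] would, for every [t] with [h t]
    in a club, make some candidate n correct for [X n] at [t]; then [T] would
    be covered by countably many members of [NS T]. *)

Require Import Defs.
From mathcomp Require Import all_boot all_order.
From mathcomp Require Import boolp classical_sets functions cardinality wochoice.
Import Order.TTheory.
Local Open Scope order_scope.
Local Open Scope classical_set_scope.

Set Implicit Arguments.
Unset Strict Implicit.
Unset Printing Implicit Defensive.

(** * Countability, well-orders and trees *)

Lemma countableU {X : Type} (A B : set X) :
  countable A -> countable B -> countable (A `|` B).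
Proof.
move=> cA cB; suff -> : A `|` B = \bigcup_(b : bool) (if b then A else B).
  by apply: bigcup_countable => // -[].
apply/seteqP; split=> x; last by move=> [[] _]; [left|right].
by case=> ?; [exists true|exists false].
Qed.

Lemma well_order_min {d} {W : orderType d} (P : set W) :
  well_order (<=%O : rel W) -> P !=set0 ->
  exists2 x, P x & forall y, P y -> x <= y.
Proof.
move=> wo [w Pw].
have [|x [[/asboolP Px xmin] _]] := wo [pred x | `[< P x >]].
  by exists w; apply/asboolP.
by exists x => // y Py; apply: xmin; apply/asboolP.
Qed.

Lemma well_order_wf {d} {W : orderType d} :
  well_order (<=%O : rel W) -> well_founded (fun x y : W => x < y).
Proof.
move=> wo x; apply: contrapT => nx.
have [y ny ymin] := well_order_min (P := [set y | ~ Acc (fun x y => x < y) y])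
  wo (ex_intro _ x nx).
apply: ny; constructor => z zy; apply: contrapT => /ymin.
by rewrite leNgt zy.
Qed.

Lemma tree_wf {d} {T : bPOrderType d} :
  is_tree T -> well_founded (fun x y : T => x < y).
Proof.
move=> tr t; constructor => s st; apply: contrapT => ns.
have [||x [[/andP[/asboolP nx xt] xmin] _]] :=
    tr t [pred s | `[< ~ Acc (fun x y : T => x < y) s >] && (s < t)].
- by move=> y /andP[].
- by exists s; apply/andP; split=> //; apply/asboolP.
apply: nx; constructor => z zx; apply: contrapT => nz.
have : x <= z.
  by apply: xmin; apply/andP; split; [apply/asboolP|exact: lt_trans zx xt].
by move=> /(lt_le_trans zx); rewrite ltxx.
Qed.

Lemma tree_comparable {d} {T : bPOrderType d} (s t u : T) :
  is_tree T -> s <= u -> t <= u -> s >=< t.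
Proof.
move=> tr; rewrite !le_eqVlt => /orP[/eqP-> tu|su].
  by apply/orP; right; rewrite le_eqVlt.
move=> /orP[/eqP->|tu]; first by apply/orP; left; exact: ltW.
exact: (wo_chainW (tr u)).
Qed.

Lemma tree_trichotomy {d} {T : bPOrderType d} (s t u : T) :
  is_tree T -> s <= u -> t <= u -> [\/ s < t, s = t | t < s].
Proof.
move=> tr su tu; have /orP[] := tree_comparable tr su tu;
  by rewrite le_eqVlt => /predU1P[->|?]; [apply: Or32|constructor].
Qed.

(** * Special sets and the ideal [NS T] *)

(** Numbering the antichains of a countable cover gives a colouring by [nat] that separates
    comparable nodes; conversely, colour classes are antichains. *)
Lemma specialP {d} {T : porderType d} (U : set T) :
  special U <->
  exists c : T -> nat, forall s t, U s -> U t -> s < t -> c s <> c t.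
Proof.
split=> [[F [/countable_injP[g ginj] FA ->]]|[c cU]].
  have /choice[A HA] : forall t, exists A,
      (\bigcup_(B in F) B) t -> F A /\ A t.
    move=> t; have [[B FB Bt]|nt] := pselect ((\bigcup_(B in F) B) t).
      by exists B.
    by exists set0.
  exists (g \o A) => s t Us Ut st /= cst.
  have [FAs As] := HA _ Us; have [FAt At] := HA _ Ut.
  have E : A s = A t by apply: ginj => //; exact: mem_set.
  move: As; rewrite E => As.
  have /(FA _ FAt _ _ As At) : s <> t by move=> E'; rewrite E' ltxx in st.
  by rewrite /Order.comparable (ltW st).
exists (range (fun n => U `&` c @^-1` [set n])); split.
- exact: sub_countable (card_image_le _ _) (countableP _).
- move=> _ [n _ <-] s t [Us /= cs] [Ut /= ct] st; apply/negP => /orP[].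
    rewrite le_eqVlt => /orP[/eqP//|/(cU _ _ Us Ut)]; congruence.
  rewrite le_eqVlt => /orP[/eqP/esym//|/(cU _ _ Ut Us)]; congruence.
- apply/seteqP; split=> [t Ut|t [_ [n _ <-] []]//].
  by exists (U `&` c @^-1` [set c t]) => //; exists (c t).
Qed.

Lemma countable_special {d} {T : porderType d} (U : set T) :
  countable U -> special U.
Proof.
move=> /countable_injP[c cinj]; apply/specialP; exists c => s t Us Ut st E.
by move: st; rewrite (cinj s t) ?ltxx//; exact: mem_set.
Qed.

(** Each node [t] of [A] picks an index [k t] with [B (k t) t] and follows the map of that index.
    Within a fibre, the pair of index and colour separates comparable nodes. *)
Lemma NS_bigcup {d} {T : bPOrderType d} (A : set T) (B : nat -> set T) :
  (forall n, NS (B n)) -> A `<=` \bigcup_n B n -> NS A.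
Proof.
move=> /choice[f Hf] AB.
have /choice[c Hc] : forall n, exists c : T -> T -> nat, forall u s t,
    B n s -> B n t -> f n s = u -> f n t = u -> s < t -> c u s <> c u t.
  move=> n; have [_ sp] := Hf n.
  have /choice[c Hc] := fun u => (specialP _).1 (sp u).
  by exists c => u s t Bs Bt fs ft; exact: Hc.
have /choice[k Hk] : forall t, exists k, A t -> B k t.
  by move=> t; have [/AB[k _ ?]|?] := pselect (A t); [exists k|exists 0%N].
exists (fun t => f (k t) t); split=> [t /Hk Bt|u].
  by have [fr _] := Hf (k t); exact: fr.
apply/specialP; exists (fun t => pickle (k t, c (k t) u t)).
move=> s t [As /= fs] [At /= ft] st /(pcan_inj pickleK)[E].
move: (Hk _ As) fs; rewrite E => Bs fs.
by apply: Hc st => //; exact: Hk.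
Qed.

Fixpoint colour_word {d} {T : bPOrderType d} (f : T -> T) (c : T -> T -> nat)
    (l : seq nat) (t : T) : Prop :=
  if l is n :: l' then
    [/\ t <> \bot, c (f t) t = n & colour_word f c l' (f t)]
  else t = \bot.

(* Iterating [f] leads from [t] to the root in finitely many steps. The word
   of the colours met on the way determines [t] among the nodes comparable
   with it, so these countably many words colour [T]. *)
Lemma NS_setT_special {d} {T : bPOrderType d} :
  is_tree T -> NS [set: T] -> special [set: T].
Proof.
move=> tr [f [fr sp]].
have {}fr t : t <> \bot -> f t < t by exact: fr.
have {sp}/choice[c Hc] := fun u => (specialP _).1 (sp u).
have {}Hc s t : f s = f t -> s < t -> c (f t) s <> c (f t) t.
  by move=> E; apply: Hc => //; split.
have /choice[l Hl] : forall t, exists l, colour_word f c l t.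
  elim/(well_founded_ind (tree_wf tr)) => t IH.
  have [->|t0] := pselect (t = \bot); first by exists [::].
  by have [l Hl] := IH _ (fr _ t0); exists (c (f t) t :: l).
have uniq_word w : forall s t, colour_word f c w s -> colour_word f c w t ->
    s >=< t -> s = t.
  elim: w => [s t -> ->//|n w IH s t [s0 cs ws] [t0 ct wt] st].
  (* Both images lie below the larger of [s] and [t], so they are comparable and the induction
     hypothesis applies. *)
  have E : f s = f t.
    have [fs ft] := (ltW (fr _ s0), ltW (fr _ t0)).
    apply: IH => //; case/orP: st => st.
      exact: (tree_comparable tr (le_trans fs st) ft).
    exact: (tree_comparable tr fs (le_trans ft st)).
  case/orP: st; rewrite le_eqVlt => /orP[/eqP//|st].
    by have := Hc _ _ E st; rewrite ct -E cs.
  by have := Hc _ _ (esym E) st; rewrite cs E ct.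
apply/specialP; exists (pickle \o l) => s t _ _ st /(pcan_inj pickleK) E.
have E' : s = t.
  by apply: (uniq_word (l t)) => //; [rewrite -E|exact: lt_comparable].
by rewrite E' ltxx in st.
Qed.

(** * Countable subsets of omega_1 *)

(** If [A] had no strict bound, the countable initial segments up to its points would cover [W]. *)
Lemma omega1_ub {d} {W : orderType d} (A : set W) :
  is_omega1 W -> countable A -> exists b, forall a, A a -> a < b.
Proof.
move=> [_ unc cb] cA; apply: contrapT => nb; apply: unc.
have H : [set: W] `<=` \bigcup_(a in A) ([set a] `|` below a).
  move=> b _; apply: contrapT => nAb; apply: nb; exists b => a Aa.
  rewrite ltNge; apply/negP; rewrite le_eqVlt => ba; apply: nAb; exists a => //.
  by case/orP: ba => [/eqP|]; [left|right].
apply: sub_countable (subset_card_le H) _.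
by apply: bigcup_countable => // a _; exact: countableU.
Qed.

Lemma omega1_countable_le {d} {W : orderType d} (a : W) :
  is_omega1 W -> countable [set b | b <= a].
Proof.
move=> o1; have [b ab] := omega1_ub o1 (countable1 a).
have [_ _ /(_ b)] := o1; apply: sub_countable; apply: subset_card_le => c /= ca.
by apply: le_lt_trans ca _; exact: ab.
Qed.

(** * Levels and the height function *)

Lemma increasing_iso {d d'} {T : bPOrderType d} {W : orderType d'} (t : T)
    (B : set W) (f : T -> W) :
  is_tree T -> (forall s, s < t -> B (f s)) ->
  (forall r s, r < s -> s < t -> f r < f s) ->
  (forall b, B b -> exists2 s, s < t & f s = b) ->
  order_isomorphic (below t) B.
Proof.
move=> tr fB finc fsurj.
have fmono : {in below t &, {mono f : r s / r <= s}}.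
  move=> r s; rewrite !inE /= => rt st.
  have [rs|->|sr] := tree_trichotomy tr (ltW rt) (ltW st).
  - by rewrite !ltW //; exact: finc.
  - by rewrite !lexx.
  - by rewrite (lt_geF sr) (lt_geF (finc _ _ sr rt)).
exists f; split=> //; split.
- exact: fB.
- move=> r s rt st E; apply/eqP; rewrite eq_le -(fmono r s) // -(fmono s r) //.
  by rewrite E lexx.
- by move=> b /fsurj[s st <-]; exists s.
Qed.

Lemma level_increasing {d d'} {T : bPOrderType d} {W : orderType d'} (t : T)
    (a : W) :
  level T a t -> exists f : T -> W,
    [/\ forall s, s < t -> f s < a,
        forall r s, r < s -> s < t -> f r < f s
      & forall b, b < a -> exists2 s, s < t & f s = b].
Proof.
move=> [f [[fB finj fsurj] fmono]]; exists f.
split=> [s /fB //|r s rs st|b /fsurj[s]]; last by exists s.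
have [/mem_set rt /mem_set st'] : below t r /\ below t s.
  by split=> //; exact: lt_trans rs st.
rewrite lt_neqAle fmono // (ltW rs) andbT; apply/eqP => /(finj _ _ rt st') E.
by rewrite E ltxx in rs.
Qed.

(** The restriction of [g] to [below s] is onto [below (g s)]: a node below [t] with a value under
    [g s] cannot be [s] or lie above it. *)
Lemma level_below {d d'} {T : bPOrderType d} {W : orderType d'} (s t : T)
    (b : W) (g : T -> W) :
  is_tree T -> s < t ->
  (forall r, r < t -> g r < b) -> (forall q r, q < r -> r < t -> g q < g r) ->
  (forall x, x < b -> exists2 r, r < t & g r = x) ->
  level T (g s) s.
Proof.
move=> tr st gb ginc gsurj; apply: (increasing_iso (f := g)) => //.
- by move=> r rs; exact: ginc.
- by move=> q r qr rs; apply: ginc => //; exact: lt_trans rs st.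
- move=> x xs; have [r rt grx] := gsurj _ (lt_trans xs (gb _ st)).
  exists r => //; rewrite -grx /below /= in xs.
  have [//|E|sr] := tree_trichotomy tr (ltW rt) (ltW st).
    by move: xs; rewrite -E ltxx.
  by have := ginc _ _ sr rt; rewrite ltNge (ltW xs).
Qed.

Lemma level_down {d d'} {T : bPOrderType d} {W : orderType d'} (s t : T)
    (a : W) :
  is_tree T -> level T a t -> s < t -> exists2 b, b < a & level T b s.
Proof.
move=> tr /level_increasing[g [gb ginc gsurj]] st; exists (g s); first exact: gb.
exact: level_below gsurj.
Qed.

Lemma level_surj {d d'} {T : bPOrderType d} {W : orderType d'} (t : T)
    (a b : W) :
  is_tree T -> level T a t -> b < a -> exists2 s, s < t & level T b s.
Proof.
move=> tr /level_increasing[g [gb ginc gsurj]] /[dup] ba /gsurj[s st <-].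
by exists s => //; exact: level_below gsurj.
Qed.

(** By induction on [t]: if [a < b], the node at level [a] below [t] would also lie at some level
    [c < a]. *)
Lemma level_unique {d d'} {T : bPOrderType d} {W : orderType d'} (t : T)
    (a b : W) :
  is_tree T -> level T a t -> level T b t -> a = b.
Proof.
move=> tr; elim/(well_founded_ind (tree_wf tr)): t a b => t IH a b.
wlog: a b / a < b.
  by move=> H la lb; case: (ltgtP a b) => // ?; [|apply/esym]; exact: H.
move=> ab la lb; have [s st las] := level_surj tr lb ab.
have [c ca lcs] := level_down tr la st.
by rewrite (IH _ st _ _ lcs las) ltxx in ca.
Qed.

Lemma tree_rank {d d'} (T : bPOrderType d) (W : orderType d') (w0 : W) :
  well_order (<=%O : rel W) -> is_tree T -> has_height T W ->
  exists h : T -> W,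
    [/\ forall t, level T (h t) t,
        forall s t, s < t -> h s < h t
      & forall t a, a < h t -> exists2 s, s < t & h s = a].
Proof.
move=> wo tr [_ noW].
have /choice[h hP] : forall t, exists a : W, level T a t.
  elim/(well_founded_ind (tree_wf tr)) => t IH.
  have /choice[h hP] : forall s, exists a : W, s < t -> level T a s.
    move=> s; have [st|nst] := pselect (s < t); last by exists w0.
    by have [a] := IH _ st; exists a.
  have hinc r s : r < s -> s < t -> h r < h s.
    move=> rs st; have [b bs lb] := level_down tr (hP _ st) rs.
    by rewrite (level_unique tr (hP r (lt_trans rs st)) lb).
  have hdown s b : s < t -> b < h s -> exists2 r, r < t & h r = b.
    move=> st /(level_surj tr (hP _ st))[r rs lb]; have rt := lt_trans rs st.
    by exists r => //; exact: level_unique (hP r rt) lb.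
  (* The heights below [t] are downward closed, so the least value they omit is the height of [t].
     Some value is omitted, since no [below t] is isomorphic to [W]. *)
  pose N := [set a | forall s, s < t -> h s <> a].
  have [ne|e] := pselect (N !=set0); last first.
    exfalso; apply: (noW t); apply: (increasing_iso (f := h)) => // b _.
    apply: contrapT => nb; apply: e; exists b => s st hsb.
    by apply: nb; exists s.
  have [a Na amin] := well_order_min wo ne.
  exists a; apply: (increasing_iso (f := h)) => // [s st|b ba].
    rewrite /below /= ltNge; apply/negP; rewrite le_eqVlt => /orP[/eqP E|].
      by apply: (Na s).
    by move=> /(hdown _ _ st)[r rt]; exact: Na.
  apply: contrapT => nb; suff /amin : N b by rewrite leNgt ba.
  by move=> s st hsb; apply: nb; exists s.
exists h; split=> // [s t st|t a].
  have [b bs lb] := level_down tr (hP t) st.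
  by rewrite (level_unique tr (hP s) lb).
move=> /(level_surj tr (hP t))[s st la].
by exists s => //; exact: level_unique (hP s) la.
Qed.

(** * Coding pairs of a node and a number *)

(** The code of [t] and [n] lies in a block reserved for [h t], at the position encoding [n] and the
    number of [t] in its fibre. The block determines the height, the position the rest. *)
Lemma countable_fibers_injection {d d'} {T : bPOrderType d} {W : orderType d'}
    (h : T -> W) :
  is_omega1 W -> (forall a, countable [set t | h t = a]) ->
  exists e : T -> nat -> W, forall s t m n, e s m = e t n -> s = t /\ m = n.
Proof.
move=> o1 ch; have [wo _ cb] := o1.
have /choice[i Hi] : forall a, exists i : T -> nat,
    forall s t, h s = a -> h t = a -> i s = i t -> s = t.
  move=> a; have /countable_injP[i iinj] := ch a; exists i => s t hs ht.
  by apply: iinj; exact: mem_set.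
(* [ub] is total; its value on uncountable sets is arbitrary. *)
have /choice[ub Hub] : forall A : set W, exists b,
    countable A -> forall a, A a -> a < b.
  move=> A; have [/(omega1_ub o1)[b Hb]|?] := pselect (countable A).
    by exists b.
  by have [b _] := omega1_ub o1 (countable0 W); exists b.
(* [S] and [k] play the roles of successor and of the enumeration of the limit
   ordinals: [k a] bounds all the points [S^n (k b)] with [b < a], so the
   [omega]-blocks starting at the [k a] are pairwise disjoint. *)
pose S b := ub [set b].
have S_gt b : b < S b by exact: (Hub [set b] (countable1 b)).
(* Here [k] takes a proof of [b < a], the form that recursion by [Fix] requires. *)
pose blocks (a : W) (k : forall b, b < a -> W) :=
  [set x | exists b (ba : b < a) n, x = iter n S (k b ba)].
have blocks_countable a k : countable (@blocks a k).
  have -> : blocks a k =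
      \bigcup_(b in below a) [set x | exists (ba : b < a) n, x = iter n S (k b ba)].
    apply/seteqP; split=> x.
      by move=> [b [ba [n ->]]]; exists b => //; exists ba, n.
    by move=> [b _ [ba [n ->]]]; exists b, ba, n.
  apply: bigcup_countable (cb a) _ => b ba.
  apply: (sub_countable _ (countableP [set: nat])).
  apply: card_le_trans (card_image_le (fun n => iter n S (k b ba)) setT).
  apply: subset_card_le => _ [ba' [n ->]]; exists n => //.
  by rewrite (bool_irrelevance ba' ba).
pose k := Fix (well_order_wf wo) (fun=> W) (fun a r => ub (blocks a r)).
have kE a : k a = ub (blocks a (fun b _ => k b)).
  rewrite /k Fix_eq // => x f g fg; congr (ub (blocks x _)).
  by apply: functional_extensionality_dep => y; apply: functional_extensionality_dep.
have k_gt a b n : b < a -> iter n S (k b) < k a.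
  move=> ba; rewrite (kE a); apply: Hub (blocks_countable _ _) _ _.
  by exists b, ba, n.
have k_le b n : k b <= iter n S (k b).
  by elim: n => //= n /le_trans; apply; apply/ltW/S_gt.
have S_inj b m n : iter m S b = iter n S b -> m = n.
  have inc i' j : (i' < j)%N -> iter i' S b < iter j S b.
    elim: j => // j IH; rewrite ltnS leq_eqVlt => /predU1P[->|/IH].
      exact: S_gt.
    by move=> /lt_trans; apply; exact: S_gt.
  by move=> E; case: (ltngtP m n) => // /inc; rewrite E ltxx.
have k_neq a b m n : a < b -> iter m S (k a) <> iter n S (k b).
  by move=> ab E; have := lt_le_trans (k_gt _ _ m ab) (k_le b n); rewrite E ltxx.
exists (fun t n => iter (pickle (i (h t) t, n)) S (k (h t))) => s t m n E.
have hst : h s = h t.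
  by case: (ltgtP (h s) (h t)) => // /k_neq; [move/(_ _ _ E)|move/(_ _ _ (esym E))].
move: E; rewrite hst => /S_inj/(pcan_inj pickleK)[E ->].
by split=> //; exact: Hi E.
Qed.

(** * Pressing down along heights *)

(** Press [t] down to a predecessor whose height is a witness [a]. Apart from the root, the fibre
    over [u] lies in the countably many countable levels up to [g (h u)]. *)
Lemma NS_rank_bounded {d d'} {T : bPOrderType d} {W : orderType d'}
    (h : T -> W) (g : W -> W) :
  is_omega1 W -> (forall a, countable [set t | h t = a]) ->
  (forall t a, a < h t -> exists2 s, s < t & h s = a) ->
  NS [set t | t = \bot \/ exists2 a, a < h t & h t <= g a].
Proof.
move=> o1 ch hsurj.
have /choice[f Hf] : forall t, exists s, t <> \bot ->
    (exists2 a, a < h t & h t <= g a) -> s < t /\ h t <= g (h s).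
  move=> t; have [[a ah hg]|?] := pselect (exists2 a, a < h t & h t <= g a);
    last by exists t.
  by have [s st hs] := hsurj _ _ ah; exists s; rewrite hs.
exists f; split=> [t [//|tg] t0|u]; first by have [] := Hf _ t0 tg.
apply: countable_special.
have H : [set t | t = \bot \/ exists2 a, a < h t & h t <= g a] `&` f @^-1` [set u]
    `<=` [set \bot] `|` \bigcup_(a in [set a | a <= g (h u)]) [set t | h t = a].
  move=> t [[->|tg] /= fu]; first by left.
  have [->|t0] := pselect (t = \bot); first by left.
  by right; exists (h t) => //=; have [_] := Hf _ t0 tg; rewrite fu.
apply: sub_countable (subset_card_le H) _; apply: countableU => //.
by apply: bigcup_countable => //; exact: omega1_countable_le.
Qed.

(** * The guessing argument *)

Theorem corollary4p3 (d d' : Order.disp_t) (W : orderType d')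
    (T : bPOrderType d) :
  is_omega1 W -> omega1_tree T W -> well_pruned T W ->
  ~ special [set: T] ->
  diamond_star W -> diamond_tree T.
Proof.
move=> o1 [tr hW clev] _ nsp [D [_ Dcount Dguess]].
have [wo _ _] := o1.
have [w0 _] := omega1_ub o1 (countable0 W).
have [h [hlev hinc hsurj]] := tree_rank w0 wo tr hW.
have ch a : countable [set t | h t = a].
  by apply: sub_countable (clev a); apply: subset_card_le => t <-.
have [e einj] := countable_fibers_injection o1 ch.
have /choice[E HE] : forall a, exists E : nat -> set W,
    forall A, D a A -> exists n, E n = A.
  move=> a; have /countable_injP[i iinj] := Dcount a.
  (* An index that numbers no guess gets the default [set0]. *)
  have /choice[E HE] : forall n, exists A, forall B, D a B -> i B = n -> A = B.
    move=> n; have [[A [DA iA]]|nA] := pselect (exists A, D a A /\ i A = n).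
      by exists A => B DB iB; apply: iinj; rewrite ?iA ?iB //; exact: mem_set.
    by exists set0 => B DB iB; exfalso; apply: nA; exists B.
  by exists E => A DA; exists (i A); exact: HE.
apply: contrapT => nD; apply/nsp/NS_setT_special => //.
have /choice[X HX] : forall n, exists X : set T,
    NS [set t | X `&` below t = [set s | s < t /\ E (h t) n (e s n)]].
  move=> n; apply: contrapT => nX; apply: nD.
  exists (fun t => [set s | s < t /\ E (h t) n (e s n)]); split=> [t s []//|X].
  by move=> HX; apply: nX; exists X.
have [C [Cunb Cclosed] Cguess] :=
  Dguess [set w | exists s n, X n s /\ w = e s n].
have /choice[g Hg] : forall a, exists c, C c /\ a < c.
  by move=> a; have [c] := Cunb a; exists c.
have /choice[g' Hg'] : forall a, exists b, forall s n, h s = a -> e s n < b.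
  move=> a; have cA : countable [set w | exists s n, h s = a /\ w = e s n].
    have H : [set w | exists s n, h s = a /\ w = e s n] `<=`
        (fun p => e p.1 p.2) @` ([set t | h t = a] `*` [set: nat]).
      by move=> _ [s [n [hs ->]]]; exists (s, n).
    apply: sub_countable (subset_card_le H) _.
    by apply: sub_countable (card_image_le _ _) _; exact: countableX.
  by have [b Hb] := omega1_ub o1 cA; exists b => s n hs; apply: Hb; exists s, n.
(* Outside [bounded g] the height is in [C]; outside [bounded g'] it is closed
   under the coding [e]. *)
pose bounded k := [set t | t = \bot \/ exists2 a, a < h t & h t <= k a].
(* Indices 0 and 1 hold the two bounded sets, so candidate [n] is at [n.+2]. *)
apply: (NS_bigcup (B := fun k => match k with
  | 0 => bounded g
  | 1 => bounded g'
  | n.+2 => [set t | X n `&` below t = [set s | s < t /\ E (h t) n (e s n)]]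
  end)) => [[|[|n]]|t _]; [exact: NS_rank_bounded..|exact: HX|].
have [tg|ntg] := pselect (bounded g t); first by exists 0%N.
have [tg'|ntg'] := pselect (bounded g' t); first by exists 1%N.
have t0 : \bot < t by rewrite lt0x; apply/eqP => t0; apply: ntg; left.
have g_lt a : a < h t -> g a < h t.
  by move=> ah; rewrite ltNge; apply/negP => hg; apply: ntg; right; exists a.
have g'_lt a : a < h t -> g' a < h t.
  by move=> ah; rewrite ltNge; apply/negP => hg; apply: ntg'; right; exists a.
(* [h t] is a limit of [C], as [g] takes values in [C] and maps [below (h t)] into itself. Since [t]
   is not the root, [g (h \bot)] is a point of [C] below [h t]. *)
have /Cguess/HE[n En] : C (h t).
  apply: Cclosed => [|b bt].
    exists (g (h \bot)); split; first by have [] := Hg (h \bot).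
    exact/g_lt/hinc.
  by have [Cg bg] := Hg b; exists (g b) => //; rewrite bg g_lt.
(* Codes of nodes below [t] lie below [h t], so cutting the coded set at [h t] loses none of them;
   injectivity of [e] decodes the guess. *)
exists n.+2 => //; apply/seteqP; split=> s.
  move=> [Xs st]; split=> //; rewrite En; split; first by exists s, n.
  exact: lt_trans (Hg' _ _ _ erefl) (g'_lt _ (hinc _ _ st)).
move=> [st]; rewrite En => -[[r [m [Xr /einj[sr nm]]]] _].
by split=> //; rewrite sr nm.
Qed.
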